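(* Let $\mathcal{D}$ be a distribution with support $w_1<\dots<w_m$ and $\Pr[w_j]=q_j$, and let $n\ge1$. (1) If a tuple $(x,y,u)$ of $m$-vectors is $n$-buyer auction feasible, then it satisfies the $n$-buyer BMSW constraints: $u_i\ge (w_i-w_j)\,y_j$ for all $i,j\in[m]$ with $i>j$; $y_i\ge x_i$ for all $i\in[m]$; $u_i\ge 0$ for all $i\in[m]$; $x$ satisfies Border's constraints for $n$ buyers; and $x$ and $y$ are monotone (nondecreasing in the index). (2) If a tuple $(x,u)$ of $m$-vectors is $n$-buyer auction feasible, then it satisfies the reduced $n$-buyer BMSW constraints: $u_i\ge (w_i-w_j)\,x_j$ for all $i,j\in[m]$ with $i>j$; $u_i\ge 0$ for all $i\in[m]$; $x$ satisfies Border's constraints for $n$ buyers; and $x$ is monotone.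
   Context: Setting. There are $n$ buyers and $T$ rounds, one item per round; buyer $i$'s value $v_{it}$ in round $t$ is drawn independently from $\mathcal{D}$, with support $0\le w_1<\dots<w_m\le1$, $\Pr[w_j]=q_j$. Asymptotics are for $T\to\infty$ with $n,\mathcal{D}$ fixed. A repeated auction consists of a finite set of arms (the same for all buyers and rounds) labelled by nonnegative bids, including $0$ and the values $w_1,\dots,w_m$, and for each round $t$ and vector $\vec b$ of arms an allocation probability $a_{it}(\vec b)\in[0,1]$ and a price $p_{it}(\vec b)\in[0,b_i a_{it}(\vec b)]$ for each buyer $i$, with $\sum_i a_{it}(\vec b)\le1$, invariance under permuting buyers, and $a_{it}(b_i;\vec b_{-i})$, $p_{it}(b_i;\vec b_{-i})$ nondecreasing in $b_i$. Strategies. A strategy $S_i$ maps the value $v_{it}$ and the past observations to a (possibly random) arm $b^{S_i}_{it}(v_{it})$. Let $r_{ibt}(v)=v\,a_{it}(b;\vec b_{-i,t})-p_{it}(b;\vec b_{-i,t})$ be the utility from arm $b$ in round $t$ given the others' pulls, and $\sigma_{i,b,s}(v)=\sum_{t<s}r_{ibt}(v)$. A clever $\gamma$-mean-based strategy is one that (i) never pulls an arm with label exceeding the current value; (ii) among the arms $b,b'\le v_{i,s}$: whenever $\sigma_{i,b,s}(v_{i,s})<\sigma_{i,b',s}(v_{i,s})-\gamma T$, arm $b$ is pulled in round $s$ with probability at most $\gamma$; (iii) is no-regret among non-overbidding bids: its expected total utility is within $o(T)$ of that of every strategy that bids a fixed function of the current value not exceeding that value, for every fixed sequence of auctions and fixed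 bids of the others. Averages. For an auction $A$ and strategies $S_1,\dots,S_n$ (expectation over all values and randomness): $X^A_{ij}=\frac1T\mathbb{E}\big[\sum_t a_{it}(b^{S_i}_{it}(w_j);b^{S_{-i}}_{-it}(v_{-it}))\big]$, $Y^A_{ij}=\frac1T\mathbb{E}\big[\sum_t a_{it}(w_j;b^{S_{-i}}_{-it}(v_{-it}))\big]$, $U^A_{ij}=\frac1T\mathbb{E}\big[\sum_t w_j a_{it}(b^{S_i}_{it}(w_j);b^{S_{-i}}_{-it}(v_{-it}))-p_{it}(b^{S_i}_{it}(w_j);b^{S_{-i}}_{-it}(v_{-it}))\big]$. Auction feasibility. $(x,y,u)$ is $n$-buyer auction feasible if there is a repeated auction $A$ such that for all $\gamma=o(1)$, whenever $n$ buyers with values i.i.d. from $\mathcal{D}$ run clever $\gamma$-mean-based strategies, then for all $i,j$: $X^A_{ij}=x_j\pm O(\gamma)$, $Y^A_{ij}=y_j\pm O(\gamma)$, $U^A_{ij}=u_j\pm O(\gamma)$. $(x,u)$ is $n$-buyer auction feasible if there is $y$ such that $(x,y,u)$ is. Border's constraints for $n$ buyers: $n\sum_{\ell\ge j}q_\ell x_\ell\le 1-\big(1-\sum_{\ell\ge j}q_\ell\big)^n$ for all $j\in[m]$. *)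

(* Defs.v *)
From HB Require Import structures.
From mathcomp Require Import all_boot all_order all_algebra all_fingroup.
From mathcomp Require Import all_classical all_reals all_analysis.
Set Implicit Arguments.
Unset Strict Implicit.
Unset Printing Implicit Defensive.
Import Order.TTheory GRing.Theory Num.Theory.
Import numFieldNormedType.Exports.
Local Open Scope classical_set_scope.
Local Open Scope ring_scope.

(* Indices start at 0: [value D j] and [vprob D j] are $w_{j+1}$ and $q_{j+1}$. *)
Record value_dist (R : realType) (m : nat) := ValueDist {
  value : 'I_m -> R;
  vprob : 'I_m -> R;
  value_ge0 : forall j, 0 <= value j;
  value_le1 : forall j, value j <= 1;
  value_incr : forall i j : 'I_m, (i < j)%N -> value i < value j;
  vprob_gt0 : forall j, 0 < vprob j;
  vprob_sum : \sum_j vprob j = 1 }.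

(* The profile $(c; \vec b_{-i})$. *)
Definition with_bid (n : nat) (B : finType)
    (b : {ffun 'I_n -> B}) (i : 'I_n) (c : B) : {ffun 'I_n -> B} :=
  [ffun k => if k == i then c else b k].

(* The rules of a single round, on arms [B] labelled by bids.  In [alloc_perm],
   buyer [i] of the permuted profile plays the part of buyer [s i]. *)
Record round_auction (R : realType) (n : nat) (B : finType) (label : B -> R) :=
  RoundAuction {
  alloc : 'I_n -> {ffun 'I_n -> B} -> R;
  price : 'I_n -> {ffun 'I_n -> B} -> R;
  alloc_bounds : forall i b, 0 <= alloc i b <= 1;
  price_bounds : forall i b, 0 <= price i b <= label (b i) * alloc i b;
  alloc_sum : forall b, \sum_i alloc i b <= 1;
  alloc_perm : forall (s : 'S_n) i (b : {ffun 'I_n -> B}),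
    alloc i [ffun k => b (s k)] = alloc (s i) b;
  price_perm : forall (s : 'S_n) i (b : {ffun 'I_n -> B}),
    price i [ffun k => b (s k)] = price (s i) b;
  alloc_mono : forall i b c c', label c <= label c' ->
    alloc i (with_bid b i c) <= alloc i (with_bid b i c');
  price_mono : forall i b c c', label c <= label c' ->
    price i (with_bid b i c) <= price i (with_bid b i c') }.

(* A repeated auction for every horizon: [rules T t] governs round [t] of [T],
   rounds being numbered from 0.  The arms do not depend on [T]. *)
Record repeated_auction (R : realType) (m n : nat) (D : value_dist R m) :=
  RepeatedAuction {
  arm : finType;
  label : arm -> R;
  label_ge0 : forall b, 0 <= label b;
  label_inj : injective label;
  zero_arm : arm;
  label_zero : label zero_arm = 0;
  value_arm : 'I_m -> arm;
  label_value : forall j, label (value_arm j) = value D j;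
  rules : nat -> nat -> round_auction n label }.

(* What a buyer learns from a round: its value, the arm it pulled, and the
   allocation probability and price that each arm would have given it. *)
Record observation (R : realType) (m : nat) (B : finType) := Observation {
  obs_value : 'I_m;
  obs_pull : B;
  obs_outcome : B -> R * R }.

(* [pull T h j b] is the probability of pulling [b] with value [value D j] after
   the observations [h] (oldest first), when the horizon is [T]; the current
   round is [size h]. *)
Record strategy (R : realType) (m : nat) (B : finType) := Strategy {
  pull : nat -> seq (observation R m B) -> 'I_m -> B -> R;
  pull_ge0 : forall T h j b, 0 <= pull T h j b;
  pull_sum : forall T h j, \sum_b pull T h j b = 1 }.

Lemma det_pull_ge0 (R : realType) (m : nat) (B : finType)
    (f : nat -> 'I_m -> B) (h : seq (observation R m B)) (j : 'I_m) (b : B) :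
  0 <= (b == f (size h) j)%:R :> R.
Proof. exact: ler0n. Qed.

Lemma det_pull_sum (R : realType) (m : nat) (B : finType)
    (f : nat -> 'I_m -> B) (h : seq (observation R m B)) (j : 'I_m) :
  \sum_b (b == f (size h) j)%:R = 1 :> R.
Proof.
rewrite (bigD1 (f (size h) j)) //= eqxx big1 ?addr0 // => b /negbTE -> //.
Qed.

(* Pull [f t j] in round [t] with value [value D j], whatever was observed. *)
Definition det_strategy (R : realType) (m : nat) (B : finType)
    (f : nat -> 'I_m -> B) : strategy R m B :=
  @Strategy R m B (fun _ h j b => (b == f (size h) j)%:R)
    (fun _ => det_pull_ge0 f) (fun _ => det_pull_sum f).

(* A complete run: the values and the pulls of all buyers in each round. *)
Definition play (m n : nat) (B : finType) (T : nat) : Type :=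
  {ffun 'I_T -> {ffun 'I_n -> 'I_m} * {ffun 'I_n -> B}}.

Definition observe (R : realType) (m n : nat) (B : finType) (label : B -> R)
    (g : round_auction n label) (i : 'I_n)
    (r : {ffun 'I_n -> 'I_m} * {ffun 'I_n -> B}) : observation R m B :=
  Observation (r.1 i) (r.2 i)
    (fun c => (alloc g i (with_bid r.2 i c), price g i (with_bid r.2 i c))).

(* The observations of buyer [i] before round [s]. *)
Definition history (R : realType) (m n : nat) (B : finType) (label : B -> R)
    (G : nat -> round_auction n label) (T : nat) (w : play m n B T)
    (i : 'I_n) (s : nat) : seq (observation R m B) :=
  [seq observe (G t) i (w t) | t : 'I_T <- enum 'I_T & (t < s)%N].

(* The law of the run: all values are independent draws from [D], and in each
   round the buyers randomize independently given their observations. *)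
Definition play_prob (R : realType) (m n : nat) (D : value_dist R m)
    (B : finType) (label : B -> R) (G : nat -> round_auction n label)
    (S : 'I_n -> strategy R m B) (T : nat) (w : play m n B T) : R :=
  \prod_(t < T) \prod_(i < n)
    (vprob D ((w t).1 i)
     * pull (S i) T (history G w i t) ((w t).1 i) ((w t).2 i)).

Definition expect (R : realType) (m n : nat) (D : value_dist R m)
    (B : finType) (label : B -> R) (G : nat -> round_auction n label)
    (S : 'I_n -> strategy R m B) (T : nat) (F : play m n B T -> R) : R :=
  \sum_(w : {ffun 'I_T -> {ffun 'I_n -> 'I_m} * {ffun 'I_n -> B}})
    play_prob D G S w * F w.

(* Utility $r_{ibt}(v)$ of arm [c], for value [v], against the others' pulls. *)
Definition arm_utility (R : realType) (n : nat) (B : finType) (label : B -> R)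
    (g : round_auction n label) (i : 'I_n) (b : {ffun 'I_n -> B})
    (v : R) (c : B) : R :=
  v * alloc g i (with_bid b i c) - price g i (with_bid b i c).

Definition cumulative_utility (R : realType) (m n : nat) (B : finType)
    (label : B -> R) (G : nat -> round_auction n label) (T : nat)
    (w : play m n B T) (i : 'I_n) (s : nat) (v : R) (c : B) : R :=
  \sum_(t < T | (t < s)%N) arm_utility (G t) i (w t).2 v c.

Definition never_overbids (R : realType) (m : nat) (D : value_dist R m)
    (B : finType) (label : B -> R) (S : strategy R m B) : Prop :=
  forall T h j b, value D j < label b -> pull S T h j b = 0.

Definition mean_based (R : realType) (m n : nat) (D : value_dist R m)
    (B : finType) (label : B -> R) (gamma : nat -> R) (i : 'I_n)
    (S : strategy R m B) : Prop :=
  forall (G : nat -> round_auction n label) (T s : nat) (w : play m n B T)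
         (j : 'I_m) (b b' : B),
    (s < T)%N -> label b <= value D j -> label b' <= value D j ->
    cumulative_utility G w i s (value D j) b
      < cumulative_utility G w i s (value D j) b' - gamma T * T%:R ->
    pull S T (history G w i s) j b <= gamma T.

Definition total_utility (R : realType) (m n : nat) (D : value_dist R m)
    (B : finType) (label : B -> R) (G : nat -> round_auction n label)
    (S : 'I_n -> strategy R m B) (T : nat) (i : 'I_n) : R :=
  expect D G S (fun w : play m n B T =>
    \sum_(t < T)
      arm_utility (G t) i (w t).2 (value D ((w t).1 i)) ((w t).2 i)).

Definition against_fixed_bids (R : realType) (m n : nat) (B : finType)
    (i : 'I_n) (S : strategy R m B) (beta : nat -> 'I_n -> B) :
    'I_n -> strategy R m B :=
  fun k => if k == i then S else det_strategy R (fun t _ => beta t k).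

(* The regret bound is worst case: uniform in the auctions, in the others' bids
   and in the benchmark. *)
Definition no_regret (R : realType) (m n : nat) (D : value_dist R m)
    (B : finType) (label : B -> R) (i : 'I_n) (S : strategy R m B) : Prop :=
  exists2 delta : nat -> R, delta =o_\oo (fun T => T%:R : R^o) &
  forall (T : nat) (G : nat -> round_auction n label) (beta : nat -> 'I_n -> B)
         (f : 'I_m -> B),
    (forall j, label (f j) <= value D j) ->
    total_utility D G
        (against_fixed_bids i (det_strategy R (fun _ => f)) beta) T i - delta T
      <= total_utility D G (against_fixed_bids i S beta) T i.

Definition clever (R : realType) (m n : nat) (D : value_dist R m)
    (B : finType) (label : B -> R) (gamma : nat -> R) (i : 'I_n)
    (S : strategy R m B) : Prop :=
  [/\ never_overbids D label S, mean_based D label gamma i S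
    & no_regret D label i S].

(* Expected value, in round [t], of [phi] at the arm that buyer [i] would pull
   if its current value were [value D j]; its past values remain random. *)
Definition at_value (R : realType) (m n : nat) (B : finType) (label : B -> R)
    (G : nat -> round_auction n label) (S : 'I_n -> strategy R m B)
    (T : nat) (w : play m n B T) (i : 'I_n) (t : 'I_T) (j : 'I_m)
    (phi : B -> R) : R :=
  \sum_c pull (S i) T (history G w i t) j c * phi c.

Definition avgX (R : realType) (m n : nat) (D : value_dist R m)
    (A : repeated_auction n D) (S : 'I_n -> strategy R m (arm A))
    (i : 'I_n) (j : 'I_m) (T : nat) : R :=
  T%:R^-1 * expect D (rules A T) S (fun w : play m n (arm A) T =>
    \sum_(t < T) at_value (rules A T) S w i t j
      (fun c => alloc (rules A T t) i (with_bid (w t).2 i c))).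

Definition avgY (R : realType) (m n : nat) (D : value_dist R m)
    (A : repeated_auction n D) (S : 'I_n -> strategy R m (arm A))
    (i : 'I_n) (j : 'I_m) (T : nat) : R :=
  T%:R^-1 * expect D (rules A T) S (fun w : play m n (arm A) T =>
    \sum_(t < T) alloc (rules A T t) i (with_bid (w t).2 i (value_arm A j))).

Definition avgU (R : realType) (m n : nat) (D : value_dist R m)
    (A : repeated_auction n D) (S : 'I_n -> strategy R m (arm A))
    (i : 'I_n) (j : 'I_m) (T : nat) : R :=
  T%:R^-1 * expect D (rules A T) S (fun w : play m n (arm A) T =>
    \sum_(t < T) at_value (rules A T) S w i t j
      (arm_utility (rules A T t) i (w t).2 (value D j))).

Definition auction_feasible (R : realType) (m n : nat) (D : value_dist R m)
    (x y u : 'I_m -> R) : Prop :=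
  exists A : repeated_auction n D,
  forall gamma : nat -> R, gamma =o_\oo (fun=> 1 : R^o) ->
  forall S : 'I_n -> strategy R m (arm A),
    (forall i, clever D (label (r := A)) gamma i (S i)) ->
  forall (i : 'I_n) (j : 'I_m),
    [/\ (fun T => avgX S i j T - x j) =O_\oo gamma,
        (fun T => avgY S i j T - y j) =O_\oo gamma
      & (fun T => avgU S i j T - u j) =O_\oo gamma].

Definition reduced_auction_feasible (R : realType) (m n : nat)
    (D : value_dist R m) (x u : 'I_m -> R) : Prop :=
  exists y : 'I_m -> R, auction_feasible n D x y u.

Definition border (R : realType) (m n : nat) (D : value_dist R m)
    (x : 'I_m -> R) : Prop :=
  forall j : 'I_m,
    n%:R * (\sum_(l < m | (j <= l)%N) vprob D l * x l)
      <= 1 - (1 - \sum_(l < m | (j <= l)%N) vprob D l) ^+ n.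

Definition monotone (R : realType) (m : nat) (x : 'I_m -> R) : Prop :=
  forall i j : 'I_m, (i <= j)%N -> x i <= x j.

Definition BMSW (R : realType) (m n : nat) (D : value_dist R m)
    (x y u : 'I_m -> R) : Prop :=
  [/\ forall i j : 'I_m, (j < i)%N -> (value D i - value D j) * y j <= u i,
      forall i, x i <= y i,
      forall i, 0 <= u i,
      border n D x
    & monotone x /\ monotone y].

Definition reduced_BMSW (R : realType) (m n : nat) (D : value_dist R m)
    (x u : 'I_m -> R) : Prop :=
  [/\ forall i j : 'I_m, (j < i)%N -> (value D i - value D j) * x j <= u i,
      forall i, 0 <= u i,
      border n D x
    & monotone x].

(* Main.v *)
(* Feasibility constrains the averages under every choice of clever strategies,
   so it suffices to exhibit one such strategy whose averages satisfy the
   constraints up to o(1).  Exponential weights, run separately for each value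
   on the arms that do not overbid it, with rate 1 / (2 sqrt T), is clever for
   gamma = 2 / T^(1/4).  Its regret bound holds on every run, which gives the
   lower bounds on u; raising the value tilts the weights towards arms with
   larger past allocation, that is, larger labels, which gives the monotonicity
   of x on every run; Border's constraints come from redrawing one buyer's value
   and pull in one round. *)

Require Import Defs.
From mathcomp Require Import all_boot all_order all_algebra.
From mathcomp Require Import all_classical all_reals all_analysis.
From mathcomp Require Import ring lra.
Set Implicit Arguments.
Unset Strict Implicit.
Unset Printing Implicit Defensive.
Import Order.TTheory GRing.Theory Num.Theory.
Import numFieldNormedType.Exports.
Local Open Scope classical_set_scope.
Local Open Scope ring_scope.

(** * The law of a run *)

(** The map [(w, x) -> (upd w x, get w)] exchanges [x] with the component read by [get]; it is an
    involution, hence a valid reindexing. *)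
Lemma sum_update (R : nmodType) (W X : finType) (upd : W -> X -> W)
    (get : W -> X) (H : W -> X -> R) :
  (forall w x, upd (upd w x) (get w) = w) ->
  (forall w x, get (upd w x) = x) ->
  \sum_w \sum_x H w x = \sum_w \sum_x H (upd w x) (get w).
Proof.
move=> updK getK; rewrite !pair_big /=.
rewrite (@reindex_inj _ _ _ _ (fun p : W * X => (upd p.1 p.2, get p.1))) //=.
by apply: (can_inj (g := fun p : W * X => (upd p.1 p.2, get p.1))) => -[w x] /=;
  rewrite updK getK.
Qed.

Lemma sum_ord_ltS (R : nmodType) (T : nat) (t : 'I_T) (f : 'I_T -> R) :
  \sum_(s < T | (s < t.+1)%N) f s = \sum_(s < T | (s < t)%N) f s + f t.
Proof.
rewrite (bigD1 t) //= addrC; congr (_ + _); apply: eq_bigl => s.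
by rewrite ltnS -val_eqE /= ltn_neqAle andbC.
Qed.

Lemma sum_outcome_prod (R : comPzRingType) (n : nat) (I B : finType)
    (g : 'I_n -> I * B -> R) :
  \sum_(e : {ffun 'I_n -> I} * {ffun 'I_n -> B}) \prod_i g i (e.1 i, e.2 i)
  = \prod_i \sum_r g i r.
Proof.
rewrite bigA_distr_bigA /=.
rewrite (reindex (fun e : {ffun 'I_n -> I} * {ffun 'I_n -> B} =>
  [ffun i => (e.1 i, e.2 i)])) /=.
  by apply: eq_bigr => e _; apply: eq_bigr => i _; rewrite ffunE.
exists (fun f : {ffun 'I_n -> I * B} => ([ffun i => (f i).1], [ffun i => (f i).2])).
  by move=> [e1 e2] _; congr pair; apply/ffunP => i; rewrite !ffunE.
by move=> f _; apply/ffunP => i; rewrite !ffunE -surjective_pairing.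
Qed.

(** [balance] is detailed balance: the kernel that redraws the component read by [get] according to
    [kappa] is reversible with respect to [p], so it preserves sums against [p]. *)
Lemma sum_redraw (R : pzRingType) (W X : finType) (upd : W -> X -> W)
    (get : W -> X) (p : W -> R) (kappa : W -> X -> R) (F : W -> R) :
  (forall w x, upd (upd w x) (get w) = w) ->
  (forall w x, get (upd w x) = x) ->
  (forall w x y, kappa (upd w x) y = kappa w y) ->
  (forall w, \sum_x kappa w x = 1) ->
  (forall w x, p (upd w x) * kappa w (get w) = p w * kappa w x) ->
  \sum_w p w * F w = \sum_w p w * \sum_x kappa w x * F (upd w x).
Proof.
move=> updK getK kappa_upd kappa_sum balance.
transitivity (\sum_w \sum_x p w * kappa w x * F w).
  by apply: eq_bigr => w _; rewrite -mulr_suml -mulr_sumr kappa_sum mulr1.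
rewrite (sum_update _ updK getK); apply: eq_bigr => w _.
rewrite mulr_sumr; apply: eq_bigr => x _.
by rewrite kappa_upd balance mulrA.
Qed.

Section Law.
Variables (R : realType) (m n : nat) (D : value_dist R m).
Variables (B : finType) (label : B -> R).
Variables (G : nat -> round_auction n label) (S : 'I_n -> strategy R m B).
Variable T : nat.

Let outcome : finType := ({ffun 'I_n -> 'I_m} * {ffun 'I_n -> B})%type.
Let run : finType := {ffun 'I_T -> outcome}.

Definition adapted (s : nat) (X : Type) (F : play m n B T -> X) : Prop :=
  forall w w' : play m n B T, (forall t : 'I_T, (t < s)%N -> w t = w' t) -> F w = F w'.

Lemma adaptedW s s' X (F : play m n B T -> X) :
  (s <= s')%N -> adapted s F -> adapted s' F.
Proof. by move=> le_ss' aF w w' ww'; apply: aF => t ts; rewrite ww' ?(leq_trans ts). Qed.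

Lemma history_adapted i s :
  adapted s (fun w : play m n B T => history G w i s).
Proof.
move=> w w' ww'; apply/eq_in_map => t; rewrite mem_filter => /andP[ts _].
by rewrite ww'.
Qed.

Definition buyer_prob (w : play m n B T) (t : nat) (i : 'I_n)
    (r : 'I_m * B) : R :=
  vprob D r.1 * pull (S i) T (history G w i t) r.1 r.2.

(** Runs keep their full length [T] and the rounds from [s] on carry no weight, so the total mass is
    [#|outcome| ^ (T - s)]; this explains the factor in [prefix_expect]. *)
Definition prefix_prob (s : nat) (w : play m n B T) : R :=
  \prod_(t < T | (t < s)%N) \prod_(i < n)
    buyer_prob w t i ((w t).1 i, (w t).2 i).

Lemma buyer_prob_ge0 w t i r : 0 <= buyer_prob w t i r.
Proof. by rewrite mulr_ge0 ?pull_ge0 ?ltW ?vprob_gt0. Qed.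

Lemma buyer_prob_sum w t i : \sum_r buyer_prob w t i r = 1.
Proof.
rewrite -(pair_bigA _ (fun j c => buyer_prob w t i (j, c))) /= -(vprob_sum D).
by apply: eq_bigr => j _; rewrite /buyer_prob /= -mulr_sumr pull_sum mulr1.
Qed.

Lemma buyer_prob_adapted t i r :
  adapted t (fun w => buyer_prob w t i r).
Proof. by move=> w w' ww'; rewrite /buyer_prob (history_adapted i ww'). Qed.

Lemma play_prob_prefix w : play_prob D G S w = prefix_prob T w.
Proof. by apply: eq_bigl => t; rewrite ltn_ord. Qed.

Lemma play_prob_ge0 (w : play m n B T) : 0 <= play_prob D G S w.
Proof. by apply: prodr_ge0 => t _; apply: prodr_ge0 => i _; exact: (buyer_prob_ge0 w t i (_, _)). Qed.

Lemma prefix_probS (t : 'I_T) w :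
  prefix_prob t.+1 w
  = prefix_prob t w * \prod_i buyer_prob w t i ((w t).1 i, (w t).2 i).
Proof.
rewrite /prefix_prob (bigD1 t) //= mulrC; congr (_ * _); apply: eq_bigl => s.
by rewrite ltnS -val_eqE /= ltn_neqAle andbC.
Qed.

Lemma prefix_prob_adapted s : adapted s (prefix_prob s).
Proof.
move=> w w' ww'; apply: eq_bigr => t ts; apply: eq_bigr => i _.
rewrite ww' //; apply: buyer_prob_adapted => t' t't.
by rewrite ww' // (ltn_trans t't).
Qed.

Definition set_round (w : run) (t : 'I_T) (e : outcome) : run :=
  [ffun s => if s == t then e else w s].

Definition set_buyer (e : outcome) (i : 'I_n) (r : 'I_m * B) : outcome :=
  ([ffun k => if k == i then r.1 else e.1 k], with_bid e.2 i r.2).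

Definition redraw (w : run) (t : 'I_T) (i : 'I_n) (r : 'I_m * B) : run :=
  set_round w t (set_buyer (w t) i r).

Lemma set_round_adapted (t : 'I_T) X (F : play m n B T -> X) w e :
  adapted t F -> F (set_round w t e) = F w.
Proof.
move=> aF; apply: aF => s st; rewrite ffunE; case: eqP => // est.
by rewrite est ltnn in st.
Qed.

Lemma prefix_prob_integrate (t : 'I_T) (F : play m n B T -> R) :
  adapted t F ->
  #|outcome|%:R * \sum_(w : run) prefix_prob t.+1 w * F w
  = \sum_(w : run) prefix_prob t w * F w.
Proof.
move=> aF; rewrite mulr_sumr.
(* The cardinality becomes a sum over a dummy outcome, which [sum_update] then places in round
   [t]. *)
under eq_bigr do rewrite mulr_natl -sumr_const.
rewrite (@sum_update _ _ _ (fun w e => set_round w t e) (fun w => w t)); first last.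
- by move=> w e; rewrite ffunE eqxx.
- by move=> w e; apply/ffunP => s; rewrite !ffunE; case: eqP => // ->.
apply: eq_bigr => w _.
under eq_bigr => e _.
  rewrite prefix_probS (set_round_adapted _ _ (@prefix_prob_adapted t)).
  rewrite (set_round_adapted _ _ aF) mulrAC.
  under eq_bigr do rewrite (set_round_adapted _ _ (@buyer_prob_adapted _ _ _)).
  rewrite ffunE eqxx.
  over.
rewrite -mulr_sumr sum_outcome_prod big1 ?mulr1 // => i _.
exact: buyer_prob_sum.
Qed.

(** Backward induction: the rounds from [T - 1] down to [s] are integrated out one at a time, each
    contributing a factor [#|outcome|]. *)
Lemma prefix_expect s (F : play m n B T -> R) : (s <= T)%N -> adapted s F ->
  #|outcome|%:R ^+ (T - s) * expect D G S F
  = \sum_(w : run) prefix_prob s w * F w.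
Proof.
suff H k : (k <= T)%N -> adapted (T - k) F ->
    #|outcome|%:R ^+ k * expect D G S F
    = \sum_(w : run) prefix_prob (T - k) w * F w.
  by move=> sT aF; rewrite (H (T - s)%N) ?leq_subr ?subKn.
elim: k => [_ _|k IHk kT aF].
  by rewrite mul1r subn0; apply: eq_bigr => w _; rewrite play_prob_prefix.
have kT' : (T - k.+1 < T)%N by rewrite ltn_subrL (leq_ltn_trans (leq0n _) kT).
rewrite exprS -mulrA IHk; first last.
- by apply: adaptedW aF; rewrite leq_sub2l.
- exact: ltnW.
by rewrite -(@prefix_prob_integrate (Ordinal kT') F) //= subnSK.
Qed.

(** Probabilities over an empty type cannot sum to 1: the law of the values yields a value, and the
    strategy of each buyer yields an arm. *)
Lemma outcome_card_gt0 : (0 < #|outcome|)%N.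
Proof.
have [j0] : exists j : 'I_m, true.
  apply: contra_notP (elimN eqP (oner_neq0 R)) => m0; rewrite -(vprob_sum D) big1 // => j.
  by case: m0; exists j.
have armP (i : 'I_n) : exists b : B, true.
  apply: contra_notP (elimN eqP (oner_neq0 R)) => B0.
  rewrite -(pull_sum (S i) T [::] j0) big1 // => b.
  by case: B0; exists b.
by rewrite (cardD1 (([ffun=> j0], [ffun i => xchoose (armP i)]) : outcome)).
Qed.

Lemma expect_prefix_eq s (F F' : play m n B T -> R) :
  (s <= T)%N -> adapted s F -> adapted s F' ->
  \sum_(w : run) prefix_prob s w * F w = \sum_(w : run) prefix_prob s w * F' w ->
  expect D G S F = expect D G S F'.
Proof.
move=> sT aF aF'; rewrite -!prefix_expect //; apply: mulfI.
by rewrite expf_neq0 // pnatr_eq0 -lt0n outcome_card_gt0.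
Qed.

Lemma expect_cst (a : R) : expect D G S (fun _ : play m n B T => a) = a.
Proof.
have N0 : #|outcome|%:R ^+ T != 0 :> R.
  by rewrite expf_neq0 // pnatr_eq0 -lt0n outcome_card_gt0.
have := @prefix_expect 0 (fun _ => a) isT (fun _ _ _ => erefl).
rewrite subn0 => e; apply: (mulfI N0); rewrite e.
under eq_bigr do rewrite /prefix_prob big_pred0 ?mul1r //.
by rewrite sumr_const card_ffun card_ord -natrX mulr_natl.
Qed.

Lemma expect_sum (I : finType) (P : pred I) (F : I -> play m n B T -> R) :
  expect D G S (fun w => \sum_(k | P k) F k w) = \sum_(k | P k) expect D G S (F k).
Proof.
by rewrite exchange_big; apply: eq_bigr => w _; rewrite mulr_sumr.
Qed.

Lemma eq_expect (F F' : play m n B T -> R) :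
  F =1 F' -> expect D G S F = expect D G S F'.
Proof. by move=> /funext ->. Qed.

Lemma expectZ (a : R) (F : play m n B T -> R) :
  expect D G S (fun w => a * F w) = a * expect D G S F.
Proof. by rewrite mulr_sumr; apply: eq_bigr => w _; rewrite mulrCA. Qed.

Lemma expectB (F F' : play m n B T -> R) :
  expect D G S (fun w => F w - F' w) = expect D G S F - expect D G S F'.
Proof. by rewrite -sumrB; apply: eq_bigr => w _; rewrite mulrBr. Qed.

Lemma le_expect (F F' : play m n B T -> R) :
  (forall w, F w <= F' w) -> expect D G S F <= expect D G S F'.
Proof.
by move=> FF'; apply: ler_sum => w _; rewrite ler_wpM2l ?FF' ?play_prob_ge0.
Qed.

(** Changing round [t] alters the histories, hence the laws, of later rounds. Truncating to the
    first [t + 1] rounds removes these, and redrawing round [t] from its conditional law then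
    preserves the truncated weight. *)
Lemma expect_round (t : 'I_T) (F : outcome -> R) :
  expect D G S (fun w => F (w t))
  = expect D G S (fun w => \sum_(e : outcome)
      (\prod_i buyer_prob w t i (e.1 i, e.2 i)) * F e).
Proof.
pose kappa (w : run) (e : outcome) := \prod_i buyer_prob w t i (e.1 i, e.2 i).
have kappa_adapted e : adapted t (kappa^~ e).
  by move=> w w' ww'; apply: eq_bigr => i _; exact: buyer_prob_adapted.
apply: (@expect_prefix_eq t.+1) => //.
- by move=> w w' ww'; rewrite ww'.
- move=> w w' ww'; apply: eq_bigr => e _; congr (_ * _); apply: kappa_adapted.
  by move=> s st; rewrite ww' // ltnS ltnW.
rewrite (@sum_redraw _ _ _ (fun w e => set_round w t e) (fun w => w t) _ kappa).
- by apply: eq_bigr => w _; congr (_ * _); apply: eq_bigr => e _; rewrite ffunE eqxx.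
- by move=> w e; apply/ffunP => s; rewrite !ffunE; case: eqP => // ->.
- by move=> w e; rewrite ffunE eqxx.
- by move=> w e e'; rewrite (set_round_adapted _ _ (kappa_adapted e')).
- move=> w; rewrite /kappa sum_outcome_prod big1 // => i _.
  exact: buyer_prob_sum.
move=> w e; rewrite !prefix_probS (set_round_adapted _ _ (@prefix_prob_adapted t)).
rewrite ffunE eqxx -/(kappa _ e) (set_round_adapted _ _ (kappa_adapted e)).
by rewrite -!mulrA; congr (_ * _); rewrite mulrC.
Qed.

Lemma with_bidK (b : {ffun 'I_n -> B}) i c c' :
  with_bid (with_bid b i c') i c = with_bid b i c.
Proof. by apply/ffunP => k; rewrite !ffunE; case: eqP. Qed.

Lemma with_bid_at (b : {ffun 'I_n -> B}) i c : with_bid b i c i = c.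
Proof. by rewrite ffunE eqxx. Qed.

(** Only the value and pull of buyer [i] in round [t] are redrawn. This converts between the value
    actually drawn and the hypothetical value in [at_value]. *)
Lemma expect_at_value (t : 'I_T) (i : 'I_n) (phi : 'I_m -> {ffun 'I_n -> B} -> R) :
  expect D G S (fun w => phi ((w t).1 i) (w t).2)
  = expect D G S (fun w => \sum_j vprob D j *
      at_value G S w i t j (fun c => phi j (with_bid (w t).2 i c))).
Proof.
have at_valueE w : \sum_j vprob D j *
      at_value G S w i t j (fun c => phi j (with_bid (w t).2 i c))
    = \sum_r buyer_prob w t i r * phi r.1 (with_bid (w t).2 i r.2).
  rewrite -(pair_bigA _ (fun j c =>
    buyer_prob w t i (j, c) * phi j (with_bid (w t).2 i c))) /=.
  apply: eq_bigr => j _; rewrite mulr_sumr; apply: eq_bigr => c _.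
  by rewrite mulrA.
transitivity (expect D G S (fun w =>
    \sum_r buyer_prob w t i r * phi r.1 (with_bid (w t).2 i r.2))); last first.
  by apply: eq_expect => w; rewrite at_valueE.
apply: (@expect_prefix_eq t.+1) => //.
- by move=> w w' ww'; rewrite ww'.
- move=> w w' ww'; apply: eq_bigr => r _; rewrite ww' //; congr (_ * _).
  by apply: buyer_prob_adapted => s st; rewrite ww' // ltnS ltnW.
rewrite (@sum_redraw _ _ _ (fun w r => redraw w t i r)
  (fun w => ((w t).1 i, (w t).2 i)) _ (fun w r => buyer_prob w t i r)).
- apply: eq_bigr => w _; congr (_ * _); apply: eq_bigr => r _.
  by rewrite !ffunE eqxx /= ffunE eqxx.
- move=> w r; apply/ffunP => s; rewrite !ffunE; case: eqP => // ->.
  rewrite eqxx [RHS]surjective_pairing; congr pair; apply/ffunP => k;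
  by rewrite !ffunE; case: eqP => // ->.
- by move=> w r; rewrite !ffunE eqxx /= !ffunE eqxx -surjective_pairing.
- by move=> w r r'; rewrite (set_round_adapted _ _ (@buyer_prob_adapted _ _ _)).
- by move=> w; exact: buyer_prob_sum.
move=> w r; rewrite !prefix_probS (set_round_adapted _ _ (@prefix_prob_adapted t)).
rewrite -!mulrA; congr (_ * _).
(* The factors of the other buyers depend on the past and on their own coordinates, which [redraw]
   keeps; only the factor of buyer [i] changes. *)
rewrite (bigD1 i) //= [in RHS](bigD1 i) //= !ffunE eqxx /= !ffunE eqxx.
rewrite -surjective_pairing (set_round_adapted _ _ (@buyer_prob_adapted _ _ _)).
rewrite [LHS]mulrC mulrA [RHS]mulrAC; congr (_ * _).
apply: eq_bigr => k ki; rewrite (set_round_adapted _ _ (@buyer_prob_adapted _ _ _)).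
by rewrite !ffunE (negbTE ki).
Qed.

Lemma total_utilityE i :
  total_utility D G S T i
  = expect D G S (fun w : play m n B T => \sum_(t < T) \sum_j vprob D j *
      at_value G S w i t j (arm_utility (G t) i (w t).2 (value D j))).
Proof.
rewrite /total_utility !expect_sum; apply: eq_bigr => t _.
rewrite (expect_at_value t i (fun j b => arm_utility (G t) i b (value D j) (b i))).
apply: eq_expect => w; apply: eq_bigr => j _; congr (_ * _).
apply: eq_bigr => c _; congr (_ * _).
by rewrite with_bid_at /arm_utility with_bidK.
Qed.

(** [det_strategy] reads the current round off the length of the history. *)
Lemma size_history (w : play m n B T) i (t : 'I_T) : size (history G w i t) = t.
Proof.
rewrite size_map size_filter -sum1_count big_enum_cond /=.
by rewrite -(big_ord_widen T (fun _ => 1%N) (ltnW (ltn_ord t))) sum1_card card_ord.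
Qed.

End Law.

(** * Exponential weights *)

(** [exp (- x) >= 1 - x] gives [exp x * (1 - x) <= 1], and [(1 + x + 2 x^2) (1 - x) = 1 + x^2 (1 - 2
    x)] is at least 1 on this range. *)
Lemma expR_le_quadratic (R : realType) (x : R) :
  0 <= x <= 2^-1 -> expR x <= 1 + x + 2 * x ^+ 2.
Proof.
move=> /andP[x0 x1].
have h : expR x * (1 - x) <= 1.
  rewrite -[leRHS](expRxMexpNx_1 x) ler_wpM2l ?expR_ge0 //.
  exact: expR_ge1Dx.
have x1' : 0 < 1 - x by lra.
rewrite -(ler_pM2r x1') (le_trans h) // -subr_ge0.
have -> : (1 + x + 2 * x ^+ 2) * (1 - x) - 1 = x ^+ 2 * (1 - 2 * x) by ring.
by rewrite mulr_ge0 ?sqr_ge0 //; lra.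
Qed.

Section Hedge.
Variables (R : realType) (B : finType) (eta : R).
Hypothesis eta_ge0 : 0 <= eta.
Implicit Types (P : pred B) (sigma : B -> R).

Definition hedge_weight P sigma (b : B) : R :=
  if P b then expR (eta * sigma b) else 0.

Definition hedge P sigma (b : B) : R :=
  hedge_weight P sigma b / \sum_c hedge_weight P sigma c.

Lemma hedge_weight_ge0 P sigma b : 0 <= hedge_weight P sigma b.
Proof. by rewrite /hedge_weight; case: ifP => // _; exact: expR_ge0. Qed.

Lemma hedge_weight_le_sum P sigma b :
  hedge_weight P sigma b <= \sum_c hedge_weight P sigma c.
Proof.
by rewrite (bigD1 b) //= lerDl sumr_ge0 // => c _; exact: hedge_weight_ge0.
Qed.

Lemma hedge_total_gt0 P sigma b : P b -> 0 < \sum_c hedge_weight P sigma c.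
Proof.
move=> Pb; apply: lt_le_trans (hedge_weight_le_sum P sigma b).
by rewrite /hedge_weight Pb expR_gt0.
Qed.

Lemma hedge_ge0 P sigma b : 0 <= hedge P sigma b.
Proof.
rewrite divr_ge0 ?hedge_weight_ge0 ?sumr_ge0 // => c _.
exact: hedge_weight_ge0.
Qed.

Lemma hedge_sum P sigma b : P b -> \sum_c hedge P sigma c = 1.
Proof. by move=> Pb; rewrite -mulr_suml divff // gt_eqF ?(hedge_total_gt0 _ Pb). Qed.

(** Only the term of [b'] is kept in the normalizer. *)
Lemma hedge_le_expR P sigma b b' : P b' ->
  hedge P sigma b <= expR (eta * (sigma b - sigma b')).
Proof.
move=> Pb'; have W0 := hedge_total_gt0 sigma Pb'.
rewrite ler_pdivrMr //.
apply: (@le_trans _ _ (expR (eta * sigma b))).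
  by rewrite /hedge_weight; case: ifP => // _; exact: expR_ge0.
rewrite -[X in X <= _](_ : expR (eta * (sigma b - sigma b')) * hedge_weight P sigma b' = _).
  by rewrite ler_wpM2l ?expR_ge0 ?hedge_weight_le_sum.
by rewrite /hedge_weight Pb' -expRD -mulrDr subrK.
Qed.

(** The potential is the total weight [W]. A round multiplies it by at most
    [exp (eta * g t + 2 * eta ^ 2)], with [g t] the mean reward, and it always dominates the weight
    of [c]; taking logarithms and dividing by [eta] gives the bound. *)
Lemma hedge_regret P (T : nat) (r : 'I_T -> B -> R) (c : B) :
  0 < eta -> eta <= 2^-1 -> (forall t b, P b -> 0 <= r t b <= 1) -> P c ->
  \sum_(t < T) r t c
  <= \sum_(t < T) \sum_b hedge P (fun b => \sum_(s < T | (s < t)%N) r s b) b * r t b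
     + (ln #|B|%:R / eta + 2 * eta * T%:R).
Proof.
move=> eta0 eta1 r01 Pc.
pose sigma (t : nat) b := \sum_(s < T | (s < t)%N) r s b.
pose W t := \sum_b hedge_weight P (sigma t) b.
pose g (t : 'I_T) := \sum_b hedge P (sigma t) b * r t b.
have W_gt0 t : 0 < W t by exact: hedge_total_gt0 Pc.
have B0 : (0 : R) < #|B|%:R by rewrite ltr0n (cardD1 c).
have step (t : 'I_T) : W t.+1 <= W t * expR (eta * g t + 2 * eta ^+ 2).
  apply: (@le_trans _ _ (W t * (1 + (eta * g t + 2 * eta ^+ 2)))); last first.
    by rewrite ler_wpM2l ?expR_ge1Dx // ltW.
  have -> : W t * (1 + (eta * g t + 2 * eta ^+ 2))
      = \sum_b hedge_weight P (sigma t) b * (1 + eta * r t b + 2 * eta ^+ 2).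
    have Wg : W t * g t = \sum_b hedge_weight P (sigma t) b * r t b.
      rewrite mulr_sumr; apply: eq_bigr => b _.
      by rewrite /hedge -/(W t) mulrA mulrCA divff ?mulr1 // gt_eqF.
    under [RHS]eq_bigr do rewrite mulrDr mulrDr mulr1 (mulrCA _ eta).
    rewrite !big_split /= -mulr_suml -mulr_sumr -Wg -/(W t).
    by ring.
  apply: ler_sum => b _; rewrite /hedge_weight; case: ifP => Pb; last by rewrite mul0r.
  rewrite /sigma sum_ord_ltS mulrDr expRD ler_wpM2l ?expR_ge0 //.
  have /andP[r0 r1] := r01 t b Pb.
  have er1 : eta * r t b <= eta by rewrite ler_piMr.
  have er0 : 0 <= eta * r t b by rewrite mulr_ge0.
  apply: le_trans (expR_le_quadratic _) _; first by rewrite er0 (le_trans er1).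
  by rewrite lerD2l ler_pM2l // ler_sqr ?nnegrE.
have bound s : (s <= T)%N ->
    W s <= #|B|%:R * expR (\sum_(t < T | (t < s)%N) (eta * g t + 2 * eta ^+ 2)).
  elim: s => [_|s IHs sT].
    (* Before the first round every arm weighs 0 or 1, so [W 0 <= #|B|]. *)
    rewrite big_pred0 // expR0 mulr1 /W -sum1_card natr_sum.
    apply: ler_sum => b _; rewrite /hedge_weight /sigma big_pred0 // mulr0 expR0.
    by case: ifP.
  rewrite (@sum_ord_ltS _ _ (Ordinal sT)) /= expRD mulrA.
  apply: le_trans (step (Ordinal sT)) _.
  by rewrite ler_wpM2r ?expR_ge0 // IHs // ltnW.
have := le_trans (hedge_weight_le_sum P (sigma T) c) (bound T (leqnn T)).
rewrite /hedge_weight Pc -{1}[#|B|%:R]lnK ?posrE // -expRD ler_expR.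
have sumT (f : 'I_T -> R) : \sum_(t < T | (t < T)%N) f t = \sum_t f t.
  by apply: eq_bigl => t; rewrite ltn_ord.
rewrite /sigma !sumT big_split /= -mulr_sumr sumr_const card_ord => h.
rewrite -(ler_pM2l eta0) (le_trans h) // -/sigma -/(g _).
rewrite -[X in _ <= _ * (X + _)]/(\sum_t g t).
rewrite mulrDr mulrDr [eta * (_ / eta)]mulrCA divff ?gt_eqF // mulr1.
rewrite -mulr_natr; lra.
Qed.

(* The likelihood ratio of the two distributions increases with the label, so
   the second one first-order stochastically dominates the first. *)
Lemma le_hedge_mean P P' sigma sigma' (label a : B -> R) (b0 : B) :
  P b0 -> (forall b, P b -> P' b) ->
  (forall c d, label d <= label c -> P c -> P d) ->
  (forall c d, label d <= label c -> P c ->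
    sigma c + sigma' d <= sigma' c + sigma d) ->
  (forall c d, label d <= label c -> a d <= a c) ->
  \sum_b hedge P sigma b * a b <= \sum_b hedge P' sigma' b * a b.
Proof.
move=> Pb0 PP' Pdown ratio a_mono.
pose f := hedge_weight P sigma; pose f' := hedge_weight P' sigma'.
have W0 := hedge_total_gt0 sigma Pb0.
have W'0 := hedge_total_gt0 sigma' (PP' _ Pb0).
have meanE Q s : \sum_b hedge Q s b * a b
    = (\sum_b hedge_weight Q s b * a b) / \sum_b hedge_weight Q s b.
  by rewrite mulr_suml; apply: eq_bigr => b _; rewrite mulrAC.
rewrite !meanE ler_pdivrMr // mulrAC ler_pdivlMr // -subr_ge0.
(* If [c] is outside [P], the left side vanishes; otherwise [Pdown] puts [d] in [P] too, and [ratio]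
   compares the exponents. *)
have likelihood c d : label d <= label c -> f c * f' d <= f' c * f d.
  move=> dc; rewrite /f /f' /hedge_weight; have [Pc|nPc] := boolP (P c).
    rewrite (PP' _ Pc) (Pdown _ _ dc Pc) (PP' _ (Pdown _ _ dc Pc)) -!expRD ler_expR.
    by rewrite -!mulrDr ler_wpM2l // ratio.
  by rewrite mul0r mulr_ge0 // -/(hedge_weight _ _ _) hedge_weight_ge0.
(* The kernel [f' c * f d - f c * f' d] is antisymmetric. *)
have swap : \sum_c \sum_d (f' c * f d - f c * f' d) * a c
    = - \sum_c \sum_d (f' c * f d - f c * f' d) * a d.
  rewrite exchange_big -sumrN; apply: eq_bigr => c _; rewrite -sumrN.
  by apply: eq_bigr => d _; ring.
have -> : (\sum_b f' b * a b) * (\sum_b f b) - (\sum_b f b * a b) * (\sum_b f' b)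
    = \sum_c \sum_d (f' c * f d - f c * f' d) * a c.
  rewrite !mulr_suml -sumrB; apply: eq_bigr => c _.
  by rewrite !mulr_sumr -sumrB; apply: eq_bigr => d _; ring.
(* By antisymmetry this sum is twice the difference of the means, cleared of denominators. Each of
   its terms is a product of two factors of equal sign, according to the order of the labels. *)
suff : 0 <= \sum_c \sum_d (f' c * f d - f c * f' d) * (a c - a d).
  under eq_bigr => c _ do under eq_bigr => d _ do rewrite mulrBr.
  under eq_bigr do rewrite sumrB.
  by rewrite sumrB; lra.
apply: sumr_ge0 => c _; apply: sumr_ge0 => d _.
have [dc|cd] := leP (label d) (label c).
  by rewrite mulr_ge0 // subr_ge0 ?likelihood ?a_mono.
rewrite mulr_le0 // subr_le0 ?a_mono ?(ltW cd) //.
by rewrite mulrC [X in _ <= X]mulrC likelihood // ltW.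
Qed.

End Hedge.

(** * A clever strategy *)

Section HedgeStrategy.
Variables (R : realType) (m : nat) (D : value_dist R m).
Variables (B : finType) (label : B -> R) (b0 : B).
Hypothesis label_b0 : label b0 = 0.

(** Makes both regret terms [ln #|B| / eta] and [2 * eta * T] of order [sqrt T]; the factor 2 keeps
    the rate at most 1/2 for [T >= 1], as [hedge_regret] requires. *)
Definition rate (T : nat) : R := (2 * Num.sqrt T%:R)^-1.

Lemma rate_ge0 T : 0 <= rate T.
Proof. by rewrite invr_ge0 mulr_ge0 ?sqrtr_ge0. Qed.

Definition affordable (j : 'I_m) (b : B) : bool := label b <= value D j.

Lemma affordable_b0 j : affordable j b0.
Proof. by rewrite /affordable label_b0 value_ge0. Qed.

Definition score (h : seq (observation R m B)) (j : 'I_m) (b : B) : R :=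
  \sum_(o <- h) (value D j * (obs_outcome o b).1 - (obs_outcome o b).2).

Definition hedge_strategy : strategy R m B :=
  @Strategy R m B
    (fun T h j => hedge (rate T) (affordable j) (score h j))
    (fun T h j b => hedge_ge0 (rate T) (affordable j) (score h j) b)
    (fun T h j => hedge_sum (rate T) (score h j) (affordable_b0 j)).

(** With [q = T^(1/4)], the gap [mean_tolerance T * T = 2 q^3] times [rate T = 1 / (2 q^2)] is
    exactly [q], and [exp (- q) <= 2 / q]. *)
Definition mean_tolerance (T : nat) : R := 2 / Num.sqrt (Num.sqrt T%:R).

Definition regret (T : nat) : R := (2 * ln #|B|%:R + 1) * Num.sqrt T%:R.

Lemma hedge_never_overbids : never_overbids D label hedge_strategy.
Proof.
by move=> T h j b vb; rewrite /= /hedge /hedge_weight /affordable leNgt vb mul0r.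
Qed.

Lemma score_history (n : nat) (G : nat -> round_auction n label) (T : nat)
    (w : play m n B T) (i : 'I_n) (s : nat) (j : 'I_m) (b : B) :
  score (history G w i s) j b = cumulative_utility G w i s (value D j) b.
Proof. by rewrite /score big_map big_filter big_enum_cond. Qed.

Lemma hedge_mean_based (n : nat) (i : 'I_n) :
  mean_based D label mean_tolerance i hedge_strategy.
Proof.
move=> G T s w j b b' sT _ vb' gap.
rewrite /=; apply: le_trans (@hedge_le_expR _ _ _ (affordable j) _ b _ vb') _.
rewrite !score_history.
set x := cumulative_utility _ _ _ _ _ b in gap *.
set x' := cumulative_utility _ _ _ _ _ b' in gap *.
have T0 : 0 < T%:R :> R by rewrite ltr0n (leq_ltn_trans _ sT).
pose q : R := Num.sqrt (Num.sqrt T%:R).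
have q0 : 0 < q by rewrite !sqrtr_gt0.
have q2 : Num.sqrt T%:R = q ^+ 2 :> R by rewrite sqr_sqrtr ?sqrtr_ge0.
have q4 : T%:R = q ^+ 4 :> R by rewrite -(@sqr_sqrtr _ T%:R) ?ler0n // q2 -exprM.
have gamma0 : 0 < mean_tolerance T by rewrite divr_gt0.
apply: (@le_trans _ _ (expR (- q))).
  rewrite ler_expR /rate q2.
  have : x - x' <= - (2 / q * q ^+ 4) by rewrite -q4; move: gap; rewrite /mean_tolerance -/q; lra.
  move=> h; have r0 : 0 <= (2 * q ^+ 2)^-1 by rewrite invr_ge0 mulr_ge0 ?sqr_ge0.
  apply: le_trans (ler_wpM2l r0 h) _; rewrite le_eqVlt; apply/orP; left; apply/eqP.
  by field; rewrite gt_eqF.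
(* After inversion, this is [q / 2 <= 1 + q <= exp q]. *)
rewrite expRN /mean_tolerance -/q -[leRHS]invrK invf_div.
rewrite lef_pV2 ?posrE ?expR_gt0 ?divr_gt0 //.
by apply: le_trans (expR_ge1Dx q); lra.
Qed.

(** The price is at most label times allocation, and the label at most the value; this is the reward
    range that [hedge_regret] asks for. *)
Lemma arm_utility_bounds (n : nat) (g : round_auction n label) (i : 'I_n)
    (b : {ffun 'I_n -> B}) (j : 'I_m) (c : B) : affordable j c ->
  0 <= arm_utility g i b (value D j) c <= 1.
Proof.
move=> vc; rewrite /arm_utility.
have /andP[a0 a1] := alloc_bounds g i (with_bid b i c).
have /andP[p0] := price_bounds g i (with_bid b i c); rewrite ffunE eqxx => p1.
rewrite subr_ge0 (le_trans p1) ?ler_wpM2r //=.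
rewrite (@le_trans _ _ (value D j * alloc g i (with_bid b i c))) ?gerBl //.
by rewrite mulr_ile1 ?value_ge0 ?value_le1.
Qed.

(** The Hedge bound holds for every reward sequence, hence on each run, for each value [j]
    separately and whatever the other buyers do. Past rounds are scored at [value D j] even where
    another value was drawn. *)
Lemma hedge_play_regret (n : nat) (G : nat -> round_auction n label)
    (S : 'I_n -> strategy R m B) (T : nat) (w : play m n B T) (i : 'I_n)
    (j : 'I_m) (c : B) : S i = hedge_strategy -> affordable j c ->
  \sum_(t < T) arm_utility (G t) i (w t).2 (value D j) c
  <= \sum_(t < T) at_value G S w i t j (arm_utility (G t) i (w t).2 (value D j))
     + regret T.
Proof.
move=> Si vc; case: T w => [|T] w.
  (* Horizon 0 is separate because [rate 0] is 0, whereas [hedge_regret] needs a positive rate. *)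
  by rewrite !big_ord0 add0r /regret sqrtr0 mulr0.
pose q : R := Num.sqrt T.+1%:R.
have q1 : 1 <= q by rewrite -[1]sqrtr1 ler_wsqrtr // ler1n.
have q0 : 0 < q by exact: lt_le_trans q1.
have rate_gt0 : 0 < rate T.+1 by rewrite invr_gt0 mulr_gt0.
have rate_le : rate T.+1 <= 2^-1.
  by rewrite lef_pV2 ?posrE ?mulr_gt0 // ler_peMr.
have /= := @hedge_regret _ _ _ (rate_ge0 T.+1) (affordable j) T.+1
  (fun t b => arm_utility (G t) i (w t).2 (value D j) b) c rate_gt0 rate_le
  (fun t b vb => arm_utility_bounds (G t) i (w t).2 vb) vc.
move/le_trans; apply; rewrite lerD //.
  rewrite le_eqVlt; apply/orP; left; apply/eqP.
  apply: eq_bigr => t _; apply: eq_bigr => b _; congr (_ * _).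
  rewrite Si /=; congr (hedge _ _ _ _); apply/funext => b'.
  by rewrite score_history.
rewrite /rate /regret -/q -(@sqr_sqrtr _ T.+1%:R) ?ler0n // -/q.
rewrite le_eqVlt; apply/orP; left; apply/eqP.
by field; rewrite gt_eqF.
Qed.

Lemma sqrt_nat_near (M : R) : \forall T \near \oo, M <= Num.sqrt (T%:R : R).
Proof.
near=> T.
have [M0|M0] := leP M 0; first by rewrite (le_trans M0) ?sqrtr_ge0.
rewrite -(ger0_norm (ltW M0)) -sqrtr_sqr ler_wsqrtr //.
by near: T; exact: nbhs_infty_ger.
Unshelve. all: by end_near. Qed.

Lemma mean_tolerance_o1 : mean_tolerance =o_\oo (fun=> 1 : R^o).
Proof.
apply/eqoP => e e0; near=> T.
have g0 : 0 <= mean_tolerance T by rewrite divr_ge0 ?sqrtr_ge0.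
rewrite normr1 mulr1 (ger0_norm g0).
have s0 : (2 / e) ^+ 2 <= Num.sqrt (T%:R : R) by near: T; exact: sqrt_nat_near.
have e2 : 0 < 2 / e by rewrite divr_gt0.
have s1 : 2 / e <= Num.sqrt (Num.sqrt (T%:R : R)).
  by rewrite -(ger0_norm (ltW e2)) -sqrtr_sqr ler_wsqrtr.
rewrite /mean_tolerance ler_pdivrMr ?(lt_le_trans e2) //.
by rewrite [leRHS]mulrC -ler_pdivrMr.
Unshelve. all: by end_near. Qed.

Lemma regret_o : regret =o_\oo (fun T => T%:R : R^o).
Proof.
apply/eqoP => e e0; near=> T.
have s0 : `|2 * ln #|B|%:R + 1| / e <= Num.sqrt (T%:R : R).
  by near: T; exact: sqrt_nat_near.
rewrite /regret normrM (ger0_norm (sqrtr_ge0 _)) (ger0_norm (ler0n R T)).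
rewrite -[X in _ <= _ * X](@sqr_sqrtr _ T%:R) // expr2 mulrA ler_wpM2r ?sqrtr_ge0 //.
by rewrite [leRHS]mulrC -ler_pdivrMr.
Unshelve. all: by end_near. Qed.

End HedgeStrategy.

(** Any other pull makes a factor of the product vanish. *)
Lemma play_prob_fixed_bids (R : realType) (m n : nat) (D : value_dist R m)
    (B : finType) (label : B -> R) (G : nat -> round_auction n label)
    (i : 'I_n) (S : strategy R m B) (beta : nat -> 'I_n -> B) (T : nat)
    (w : play m n B T) (t : 'I_T) (k : 'I_n) :
  play_prob D G (against_fixed_bids i S beta) w != 0 -> k != i ->
  (w t).2 k = beta t k.
Proof.
move=> w0 ki; apply: contraNeq w0 => wtk.
rewrite /play_prob (bigD1 t) //= (bigD1 k) //= {1}/against_fixed_bids (negbTE ki).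
by rewrite /= size_history (negbTE wtk) mulr0 !mul0r.
Qed.

Lemma expect_fixed_bids (R : realType) (m n : nat) (D : value_dist R m)
    (B : finType) (label : B -> R) (G : nat -> round_auction n label)
    (i : 'I_n) (S : strategy R m B) (beta : nat -> 'I_n -> B) (T : nat)
    (t : 'I_T) (v : R) (c : B) :
  expect D G (against_fixed_bids i S beta)
    (fun w : play m n B T => arm_utility (G t) i (w t).2 v c)
  = arm_utility (G t) i [ffun k => beta t k] v c.
Proof.
rewrite -[RHS](@expect_cst _ _ _ D _ _ G (against_fixed_bids i S beta) T).
apply: eq_bigr => w _.
have [->|w0] := eqVneq (play_prob D G (against_fixed_bids i S beta) w) 0.
  by rewrite !mul0r.
congr (_ * _); rewrite /arm_utility.
suff -> : with_bid (w t).2 i c = with_bid [ffun k => beta t k] i c by [].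
apply/ffunP => k; rewrite !ffunE; case: eqP => // /eqP ki.
exact: play_prob_fixed_bids w0 ki.
Qed.

Lemma hedge_no_regret (R : realType) (m n : nat) (D : value_dist R m)
    (B : finType) (label : B -> R) (b0 : B) (label_b0 : label b0 = 0)
    (i : 'I_n) :
  no_regret D label i (hedge_strategy D label_b0).
Proof.
exists (@regret R B); first exact: regret_o.
move=> T G beta f fv; set S := hedge_strategy D label_b0.
have Si : against_fixed_bids i S beta i = S by rewrite /against_fixed_bids eqxx.
rewrite !total_utilityE lerBlDr.
pose A (S' : strategy R m B) := against_fixed_bids (n := n) i S' beta.
rewrite -/(A S) -/(A (det_strategy R (fun=> f))).
have sum_fixed (w : play m n B T) : \sum_(t < T) \sum_j vprob D j *
      at_value G (A (det_strategy R (fun=> f))) w i t j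
        (arm_utility (G t) i (w t).2 (value D j))
    = \sum_(t < T) \sum_j vprob D j * arm_utility (G t) i (w t).2 (value D j) (f j).
  apply: eq_bigr => t _; apply: eq_bigr => j _; congr (_ * _).
  rewrite /at_value /A {1}/against_fixed_bids eqxx /=.
  rewrite (bigD1 (f j)) //= eqxx mul1r big1 ?addr0 // => c /negbTE ->.
  by rewrite mul0r.
(* The benchmark does not depend on the strategy of buyer [i], so it can be evaluated under the law
   of the Hedge run and compared run by run. *)
have benchmarkE S' : expect D G (A S') (fun w : play m n B T =>
      \sum_(t < T) \sum_j vprob D j * arm_utility (G t) i (w t).2 (value D j) (f j))
    = \sum_(t < T) \sum_j vprob D j *
        arm_utility (G t) i [ffun k => beta t k] (value D j) (f j).
  rewrite expect_sum; apply: eq_bigr => t _.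
  rewrite expect_sum; apply: eq_bigr => j _.
  by rewrite expectZ expect_fixed_bids.
rewrite (eq_expect _ _ _ sum_fixed) benchmarkE -(benchmarkE S) -lerBlDl -expectB.
rewrite -[leRHS](@expect_cst _ _ _ D _ _ G (A S) T).
apply: le_expect => w; rewrite lerBlDl.
(* The regret is split over the values using that [vprob D] sums to 1. *)
rewrite exchange_big [in leRHS]exchange_big /= -[X in _ + X]mul1r.
rewrite -(vprob_sum D) mulr_suml -big_split; apply: ler_sum => j _ /=.
rewrite -!mulr_sumr -mulrDr ler_wpM2l ?(ltW (vprob_gt0 _ _)) //.
by apply: (@hedge_play_regret _ _ D _ _ _ label_b0 _ G (A S)) (fv j); exact: Si.
Qed.

Lemma hedge_clever (R : realType) (m n : nat) (D : value_dist R m)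
    (B : finType) (label : B -> R) (b0 : B) (label_b0 : label b0 = 0)
    (i : 'I_n) :
  clever D label (@mean_tolerance R) i (hedge_strategy D label_b0).
Proof.
split; [exact: hedge_never_overbids | exact: hedge_mean_based
       | exact: hedge_no_regret].
Qed.

(** * The constraints *)

Lemma le_value (R : realType) (m : nat) (D : value_dist R m) (i j : 'I_m) :
  (i <= j)%N -> value D i <= value D j.
Proof.
rewrite leq_eqVlt => /orP[/eqP/val_inj-> //|ij].
exact: ltW (value_incr D ij).
Qed.

(** * Border's constraints in a single round *)

Section Border.
Variables (R : realType) (m n : nat) (D : value_dist R m).
Variables (B : finType) (label : B -> R).
Variables (G : nat -> round_auction n label) (S : 'I_n -> strategy R m B).
Variables (T : nat) (t : 'I_T) (j : 'I_m).

Lemma expect_all_below :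
  expect D G S (fun w : play m n B T => \prod_i ((w t).1 i < j)%N%:R)
  = (1 - \sum_(l < m | (j <= l)%N) vprob D l) ^+ n.
Proof.
rewrite (expect_round D G S t (fun e => \prod_i (e.1 i < j)%N%:R)).
rewrite -[RHS](@expect_cst _ _ _ D _ _ G S T); apply: eq_expect => w.
transitivity (\sum_(e : {ffun 'I_n -> 'I_m} * {ffun 'I_n -> B})
    \prod_i (buyer_prob D G S w t i (e.1 i, e.2 i) * (e.1 i < j)%N%:R)).
  by apply: eq_bigr => e _; rewrite [in RHS]big_split.
rewrite [LHS](sum_outcome_prod
  (fun i r => buyer_prob D G S w t i r * (r.1 < j)%N%:R)).
rewrite -[X in _ = _ ^+ X]card_ord -prodr_const; apply: eq_bigr => i _.
rewrite -(pair_bigA _ (fun l c => buyer_prob D G S w t i (l, c) * (l < j)%N%:R)) /=.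
apply/eqP; rewrite eq_sym subr_eq -[X in X == _](vprob_sum D) [X in _ + X]big_mkcond /= -big_split /=; apply/eqP.
apply: eq_bigr => l _; rewrite /buyer_prob /= -mulr_suml -mulr_sumr pull_sum mulr1.
by rewrite ltnNge; case: leqP => _; rewrite /= ?mulr0 ?mulr1 ?add0r ?addr0.
Qed.

(** On every run, the total allocation to buyers whose drawn value has index at least [j] is at most
    the indicator that such a buyer exists, whose expectation is the right side by
    [expect_all_below]. *)
Lemma border_round :
  \sum_i \sum_(l < m | (j <= l)%N) vprob D l *
    expect D G S (fun w : play m n B T =>
      at_value G S w i t l (fun c => alloc (G t) i (with_bid (w t).2 i c)))
  <= 1 - (1 - \sum_(l < m | (j <= l)%N) vprob D l) ^+ n.
Proof.
(* Interim allocations at hypothetical values become allocations at the values actually drawn. *)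
have interimE i : \sum_(l < m | (j <= l)%N) vprob D l *
    expect D G S (fun w : play m n B T =>
      at_value G S w i t l (fun c => alloc (G t) i (with_bid (w t).2 i c)))
    = expect D G S (fun w => (j <= (w t).1 i)%N%:R * alloc (G t) i (w t).2).
  rewrite (expect_at_value D G S t i (fun l b => (j <= l)%N%:R * alloc (G t) i b)).
  rewrite expect_sum big_mkcond; apply: eq_bigr => l _.
  rewrite expectZ; case: (j <= l)%N.
    congr (_ * _); apply: eq_expect => w; apply: eq_bigr => c _.
    by rewrite mul1r.
  rewrite -[LHS](mulr0 (vprob D l)) -(@expect_cst _ _ _ D _ _ G S T 0).
  congr (_ * _); apply: eq_expect => w.
  by rewrite /at_value big1 // => c _; rewrite mul0r mulr0.
under eq_bigr do rewrite interimE.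
rewrite -expect_sum -[X in _ <= X - _](@expect_cst _ _ _ D _ _ G S T).
rewrite -expect_all_below -expectB; apply: le_expect => w.
(* If some drawn value reaches index [j], the right side is 1 and [alloc_sum] bounds the left;
   otherwise both sides are 0. *)
have [i ji|below] := pickP (fun i => j <= (w t).1 i)%N.
  rewrite [X in 1 - X](bigD1 i) //= ltnNge ji mul0r subr0.
  apply: le_trans (alloc_sum (G t) (w t).2); apply: ler_sum => k _.
  have /andP[a0 _] := alloc_bounds (G t) k (w t).2.
  by case: (j <= _)%N; rewrite ?mul1r ?mul0r.
rewrite big1; first by rewrite big1 ?subrr // => i _; rewrite ltnNge below.
by move=> i _; rewrite below mul0r.
Qed.

End Border.

(** * Constraints on the averages at a finite horizon *)

Section HedgeAverages.
Variables (R : realType) (m n : nat) (D : value_dist R m).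
Variable A : repeated_auction n D.

Definition hedgers (_ : 'I_n) : strategy R m (arm A) :=
  hedge_strategy D (label_zero A).

Lemma avg_le (F F' : forall T, play m n (arm A) T -> R) (T : nat) :
  (forall w, F T w <= F' T w) ->
  T%:R^-1 * expect D (rules A T) hedgers (F T)
  <= T%:R^-1 * expect D (rules A T) hedgers (F' T).
Proof. by move=> FF'; rewrite ler_wpM2l ?invr_ge0 // le_expect. Qed.

Lemma hedge_pull_unaffordable T h (i : 'I_n) (j : 'I_m) (c : arm A) :
  value D j < label c -> pull (hedgers i) T h j c = 0.
Proof. by move=> vc; exact: hedge_never_overbids. Qed.

(** Every arm pulled with positive probability has label at most the value, so bidding the value
    wins at least as much. *)
Lemma avgX_le_avgY i j T : avgX hedgers i j T <= avgY hedgers i j T.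
Proof.
apply: (avg_le (F := fun T w => _) (F' := fun T w => _)) => w.
apply: ler_sum => t _.
rewrite -[leRHS]mul1r -(pull_sum (hedgers i) T (history (rules A T) w i t) j).
rewrite mulr_suml; apply: ler_sum => c _.
have [vc|vc] := leP (label c) (value D j); last first.
  by rewrite hedge_pull_unaffordable // !mul0r.
by rewrite ler_wpM2l ?pull_ge0 // alloc_mono // label_value.
Qed.

Lemma avgU_ge0 i j T : 0 <= avgU hedgers i j T.
Proof.
rewrite mulr_ge0 ?invr_ge0 //.
rewrite -[leLHS](@expect_cst _ _ _ D _ _ (rules A T) hedgers T).
apply: le_expect => w; apply: sumr_ge0 => t _; apply: sumr_ge0 => c _.
have [vc|vc] := leP (label c) (value D j); last first.
  by rewrite hedge_pull_unaffordable // mul0r.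
by rewrite mulr_ge0 ?pull_ge0 //; case/andP: (arm_utility_bounds (rules A T t) i (w t).2 vc).
Qed.

Lemma avgY_mono i (j j' : 'I_m) T : (j <= j')%N -> avgY hedgers i j T <= avgY hedgers i j' T.
Proof.
move=> jj'; apply: (avg_le (F := fun T w => _) (F' := fun T w => _)) => w.
by apply: ler_sum => t _; rewrite alloc_mono // !label_value le_value.
Qed.

Lemma avgX_mono i (j j' : 'I_m) T : (j <= j')%N -> avgX hedgers i j T <= avgX hedgers i j' T.
Proof.
move=> jj'; apply: (avg_le (F := fun T w => _) (F' := fun T w => _)) => w.
apply: ler_sum => t _.
(* On a fixed run both values use the same history, so the two pull distributions can be compared
   directly. *)
apply: (@le_hedge_mean _ _ _ (rate_ge0 R T) _ _ _ _ (@label _ _ _ _ A) _ (zero_arm A)).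
- exact: affordable_b0 (label_zero A) j.
- by move=> b vb; apply: le_trans vb (le_value D jj').
- by move=> c d dc; exact: le_trans.
(* Raising the value adds the value gap times the past allocation to each score, and prices cancel;
   this increment is nondecreasing in the label. *)
- move=> c d dc _; rewrite !score_history -!big_split /=; apply: ler_sum => s _.
  rewrite /arm_utility; have := alloc_mono (rules A T s) i (w s).2 dc.
  have := le_value D jj'.
  set x := alloc _ _ _; set y := alloc _ _ _ => vv' xy.
  have : 0 <= (value D j' - value D j) * (y - x) by rewrite mulr_ge0 ?subr_ge0.
  lra.
- by move=> c d dc; rewrite alloc_mono.
Qed.

(** The benchmark always bids the lower value [value D j'], affordable at [value D j]; its price is
    at most [value D j'] times its allocation. *)
Lemma avgU_ge_lower_value i (j j' : 'I_m) T : (j' < j)%N ->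
  (value D j - value D j') * avgY hedgers i j' T - T%:R^-1 * regret R (arm A) T
  <= avgU hedgers i j T.
Proof.
move=> j'j; rewrite mulrCA -mulrBr ler_wpM2l ?invr_ge0 //.
rewrite -expectZ -[regret _ _ _](@expect_cst _ _ _ D _ _ (rules A T) hedgers T).
rewrite -expectB; apply: le_expect => w; rewrite lerBlDr.
have vj' : affordable D (@label _ _ _ _ A) j (value_arm A j').
  by rewrite /affordable label_value le_value // ltnW.
apply: le_trans _ (@hedge_play_regret _ _ D _ _ _ (label_zero A) _ _ hedgers
  _ w i j _ erefl vj').
rewrite mulr_sumr; apply: ler_sum => t _; rewrite mulrBl lerD2l lerN2.
have /andP[_] := price_bounds (rules A T t) i (with_bid (w t).2 i (value_arm A j')).
by rewrite with_bid_at label_value.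
Qed.

(** The sum over buyers stays explicit: the averages of different buyers are identified only in the
    limit, where feasibility gives all of them the same [x]. *)
Lemma border_avgX (j : 'I_m) T : (0 < T)%N ->
  \sum_i \sum_(l < m | (j <= l)%N) vprob D l * avgX hedgers i l T
  <= 1 - (1 - \sum_(l < m | (j <= l)%N) vprob D l) ^+ n.
Proof.
move=> T0; have T0' : 0 < T%:R :> R by rewrite ltr0n.
have -> : \sum_i \sum_(l < m | (j <= l)%N) vprob D l * avgX hedgers i l T
    = T%:R^-1 * \sum_(t < T) \sum_i \sum_(l < m | (j <= l)%N) vprob D l *
      expect D (rules A T) hedgers (fun w : play m n (arm A) T =>
        at_value (rules A T) hedgers w i t l
          (fun c => alloc (rules A T t) i (with_bid (w t).2 i c))).
  rewrite [in RHS]exchange_big mulr_sumr; apply: eq_bigr => i _.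
  rewrite [in RHS]exchange_big mulr_sumr; apply: eq_bigr => l _.
  by rewrite /avgX expect_sum mulrCA mulr_sumr.
rewrite mulrC ler_pdivrMr //.
apply: le_trans (ler_sum _ (fun t _ => border_round D (rules A T) hedgers t j)) _.
by rewrite sumr_const card_ord mulr_natr.
Qed.

End HedgeAverages.

(** * Passage to the limit *)

Lemma bigO_cvg (R : realType) (f gamma : nat -> R) (l : R) :
  gamma =o_\oo (fun=> 1 : R^o) -> (fun T => f T - l) =O_\oo gamma ->
  f @ \oo --> l.
Proof.
move=> /eqoP small /eqO_exP[k k0 fl]; apply/cvgrPdist_le => e e0; near=> T.
rewrite distrC; apply: (@le_trans _ _ (k * `|gamma T|)); first by near: T.
rewrite mulrC -ler_pdivlMr // -[leRHS]mulr1 -[X in _ * X](@normr1 R).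
by near: T; apply: small; rewrite divr_gt0.
Unshelve. all: by end_near. Qed.

Lemma regret_rate_cvg0 (R : realType) (B : finType) :
  T%:R^-1 * regret R B T @[T --> \oo] --> (0 : R).
Proof.
have /eqoP small := @regret_o R B; apply/cvgrPdist_le => e e0; near=> T.
have T0 : (0 < T)%N by near: T; exact: nbhs_infty_gt.
have T0' : 0 < T%:R :> R by rewrite ltr0n.
rewrite sub0r normrN normrM (@ger0_norm _ T%:R^-1) ?invr_ge0 // mulrC.
rewrite ler_pdivrMr // -[X in _ * X](ger0_norm (ltW T0')).
by near: T; exact: small.
Unshelve. all: by end_near. Qed.

Lemma cvgr_sum (R : realType) (I : finType) (P : pred I) (f : I -> nat -> R)
    (a : I -> R) :
  (forall i, P i -> f i @ \oo --> a i) ->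
  (\sum_(i | P i) f i T) @[T --> \oo] --> \sum_(i | P i) a i.
Proof. by move=> fa; apply: (cvg_big (@add_continuous R)). Qed.

Lemma auction_feasible_BMSW (R : realType) (m n : nat) (D : value_dist R m)
    (x y u : 'I_m -> R) :
  (0 < n)%N -> auction_feasible n D x y u -> BMSW n D x y u.
Proof.
move=> n0 [A feasible].
have {}feasible := feasible _ (@mean_tolerance_o1 R) (hedgers A)
  (fun i => hedge_clever D (label_zero A) i).
have Xcvg i j : avgX (hedgers A) i j @ \oo --> x j.
  by have [+ _ _] := feasible i j; apply: bigO_cvg; exact: mean_tolerance_o1.
have Ycvg i j : avgY (hedgers A) i j @ \oo --> y j.
  by have [_ + _] := feasible i j; apply: bigO_cvg; exact: mean_tolerance_o1.
have Ucvg i j : avgU (hedgers A) i j @ \oo --> u j.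
  by have [_ _] := feasible i j; apply: bigO_cvg; exact: mean_tolerance_o1.
(* Apart from Border's, every constraint is read off a single buyer, which [n >= 1] provides. *)
pose i0 := Ordinal n0; split.
- move=> i j ji; rewrite -[leLHS]subr0.
  have lower : (value D i - value D j) * avgY (hedgers A) i0 j T
      - T%:R^-1 * regret R (arm A) T @[T --> \oo]
      --> (value D i - value D j) * y j - 0.
    by apply: cvgB; [apply: cvgM (cvg_cst _) (Ycvg i0 j) | exact: regret_rate_cvg0].
  apply: ler_cvg_to lower (Ucvg i0 i) _.
  by apply: nearW => T; exact: avgU_ge_lower_value.
- move=> j; apply: ler_cvg_to (Xcvg i0 j) (Ycvg i0 j) _.
  by apply: nearW => T; exact: avgX_le_avgY.
- move=> j; apply: ler_cvg_to (cvg_cst 0) (Ucvg i0 j) _.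
  by apply: nearW => T; exact: avgU_ge0.
- move=> j.
  have -> : n%:R * (\sum_(l < m | (j <= l)%N) vprob D l * x l)
      = \sum_(i < n) \sum_(l < m | (j <= l)%N) vprob D l * x l.
    by rewrite sumr_const card_ord mulr_natl.
  pose X_sum T := \sum_(i < n) \sum_(l < m | (j <= l)%N)
    vprob D l * avgX (hedgers A) i l T.
  have X_sum_cvg : X_sum @ \oo -->
      \sum_(i < n) \sum_(l < m | (j <= l)%N) vprob D l * x l.
    apply: (@cvgr_sum _ _ _ (fun i T => \sum_(l < m | (j <= l)%N)
      vprob D l * avgX (hedgers A) i l T)) => i _.
    apply: (@cvgr_sum _ _ _ (fun l T => vprob D l * avgX (hedgers A) i l T)) => l _.
    exact: cvgM (cvg_cst _) (Xcvg i l).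
  apply: ler_cvg_to X_sum_cvg (cvg_cst _) _.
  near=> T; apply: border_avgX; near: T; exact: nbhs_infty_gt.
- split=> j j' jj'.
    apply: ler_cvg_to (Xcvg i0 j) (Xcvg i0 j') _.
    by apply: nearW => T; exact: avgX_mono.
  apply: ler_cvg_to (Ycvg i0 j) (Ycvg i0 j') _.
  by apply: nearW => T; exact: avgY_mono.
Unshelve. all: by end_near. Qed.

Theorem proposition15 (R : realType) (m n : nat) (D : value_dist R m)
    (hn : (1 <= n)%N) :
  (forall x y u : 'I_m -> R, auction_feasible n D x y u -> BMSW n D x y u) /\
  (forall x u : 'I_m -> R,
     reduced_auction_feasible n D x u -> reduced_BMSW n D x u).
Proof.
split=> [x y u|x u [y]]; first exact: auction_feasible_BMSW.
move=> /(auction_feasible_BMSW hn)[IC xy u0 xborder [xmono _]]; split=> // i j ji.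
(* The value gap is nonnegative and [x j <= y j], so [x] may replace [y]. *)
apply: le_trans (IC i j ji).
by rewrite ler_wpM2l // subr_ge0 ltW // value_incr.
Qed.
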